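(* Let $c>0$ and let $r\ge1$ be a natural number. For all real $x$ with $0\le x\le 2c$, $$\begin{aligned}\sum_{n=1}^\infty\frac{1}{n^{2r+1}}\cos\frac{n\pi x}{c}=\ &\sum_{k=0}^{r-1}(-1)^k\frac{1}{(2k)!}\left(\frac{\pi x}{c}\right)^{2k}\zeta(2r+1-2k)\\&+(-1)^r\frac{1}{(2r)!}\left(\frac{\pi x}{c}\right)^{2r}\left(H_{2r}-\ln\frac{\pi x}{c}\right)\\&+(-1)^r\left(\frac{\pi x}{c}\right)^{2r}\sum_{k=1}^\infty\frac{(2k-1)!\,\zeta(2k)}{2^{2k-1}(2r+2k)!}\left(\frac{x}{c}\right)^{2k}.\end{aligned}$$
   Context: $\zeta$ is the Riemann zeta function and $H_m=\sum_{j=1}^m 1/j$ are the harmonic numbers. At $x=0$ the term $(\pi x/c)^{2r}\ln(\pi x/c)$ is understood as its limit $0$, and $(\pi x/c)^0=1$. *)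

(* Defs.v *)
From Stdlib Require Import Reals Factorial.
From Coquelicot Require Import Coquelicot.
Open Scope R_scope.

(* The Riemann zeta function on the real half-line [s > 1], as its Dirichlet
   series; the value of the total operator [Series] is meaningless for
   [s <= 1]. *)
Definition zeta (s : R) : R :=
  Series (fun n : nat => / Rpower (INR (S n)) s).

Definition harmonic (m : nat) : R := sum_n_m (fun j : nat => / INR j) 1 m.

(* Both terms below are meant for indices starting at 1; since [Series] starts
   at 0, they are summed with the index shifted by [S]. *)
Definition cosine_series_term (c : R) (r : nat) (x : R) (n : nat) : R :=
  1 / INR n ^ (2 * r + 1) * cos (INR n * PI * x / c).

Definition zeta_series_term (c : R) (r : nat) (x : R) (k : nat) : R :=
  INR (fact (2 * k - 1)) * zeta (INR (2 * k))
    / (2 ^ (2 * k - 1) * INR (fact (2 * r + 2 * k)))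
    * (x / c) ^ (2 * k).

(* Main.v *)
(* Put t = PI x / c, in [0, 2 PI]. Both sides come by 2r successive integrations
   from the formal identity
     sum cos(nt)/n = - ln (2 sin (t/2)) = - ln t + sum_k zeta(2k)/k (t/(2 PI))^(2k),
   where the second equality is the logarithm of the product
   sin(PI u)/(PI u) = prod (1 - u^2/m^2). Truncate every series at N and let
   [defect j N] be the difference of the two sides after j integrations, so
   that [defect (S j) N] vanishes at 0+ and has derivative [defect j N].
   [defect 0 N] tends to 0 uniformly only on compact subsets of (0, 2 PI), but the
   series of level 1 converge normally, which gives |defect 1 N| = O(1/N) on
   the whole of (0, 2 PI]; the mean value inequality carries this bound to level 2r. *)
Require Import Defs.
From Stdlib Require Import Reals Factorial Arith Lra Lia.
From Coquelicot Require Import Coquelicot.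
Open Scope R_scope.

(** At both ends of (0, 2 PI) the cosine sums of level 0 grow like the harmonic series, so no
    estimate of [defect 0 N] reaches them. Its only use is to show that the limit of level 1 has
    zero derivative inside the interval, hence is constant; the value at 0+ then fixes the constant.
    Truncation keeps every differentiation on a finite sum: no series is ever differentiated or
    integrated term by term. The sine product comes from the quotient of the integrals over
    [0, PI/2] of cos(2ux) cos^n x and of cos^n x. A recurrence from n to n + 2 produces the factors
    1 - u^2/k^2, the start n = 0 is sin(PI u)/(PI u), and the quotient tends to 1 because cos^n x
    concentrates near 0. *)

(** * Finite sums and mean value inequalities *)

(** Counts terms, unlike [sum_n]: the empty sum is available, as level 0 of [taylor_part]
    requires. *)
Fixpoint psum (f : nat -> R) (N : nat) : R :=
  match N with
  | O => 0
  | S n => psum f n + f n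
  end.

Lemma psum_sum_n (f : nat -> R) (N : nat) : psum f (S N) = sum_n f N.
Proof.
induction N as [|N IH].
- rewrite sum_O. simpl. ring.
- rewrite sum_Sn, <- IH. reflexivity.
Qed.

Lemma psum_ext (f g : nat -> R) (N : nat) :
  (forall k, (k < N)%nat -> f k = g k) -> psum f N = psum g N.
Proof.
induction N as [|N IH]; intros H; simpl; [reflexivity|].
rewrite IH by (intros; apply H; lia). rewrite H by lia. reflexivity.
Qed.

Lemma psum_le (f g : nat -> R) (N : nat) :
  (forall k, (k < N)%nat -> f k <= g k) -> psum f N <= psum g N.
Proof.
induction N as [|N IH]; intros H; simpl; [lra|].
apply Rplus_le_compat; [apply IH; intros; apply H; lia | apply H; lia].
Qed.

Lemma psum_scal (a : R) (f : nat -> R) (N : nat) :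
  psum (fun k => a * f k) N = a * psum f N.
Proof. induction N as [|N IH]; simpl; [ring | rewrite IH; ring]. Qed.

Lemma psum_exchange (f : nat -> nat -> R) (M N : nat) :
  psum (fun i => psum (fun j => f i j) N) M =
  psum (fun j => psum (fun i => f i j) M) N.
Proof.
induction M as [|M IH]; simpl.
- induction N as [|N IHN]; simpl; [reflexivity | rewrite <- IHN; ring].
- rewrite IH. clear IH.
  induction N as [|N IHN]; simpl; [ring | rewrite <- IHN; ring].
Qed.

Lemma psum_Sl (f : nat -> R) (N : nat) :
  psum f (S N) = f O + psum (fun k => f (S k)) N.
Proof.
induction N as [|N IH]; [simpl; ring|].
change (psum f (S (S N))) with (psum f (S N) + f (S N)).
rewrite IH. simpl. ring.
Qed.

Lemma psum_double (f : nat -> R) (N : nat) :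
  psum f (2 * N) = psum (fun k => f (2 * k)%nat + f (2 * k + 1)%nat) N.
Proof.
induction N as [|N IH]; [reflexivity|].
replace (2 * S N)%nat with (S (S (2 * N))) by lia.
cbn [psum]. rewrite IH. replace (2 * N + 1)%nat with (S (2 * N)) by lia. ring.
Qed.

Lemma psum_tail (f g : nat -> R) (N M : nat) :
  (N <= M)%nat -> (forall k, Rabs (f k) <= g k) ->
  Rabs (psum f M - psum f N) <= psum g M - psum g N.
Proof.
intros HNM H. induction HNM as [|M HNM IH].
- rewrite !Rminus_diag, Rabs_R0. lra.
- simpl. specialize (H M).
  replace (psum f M + f M - psum f N) with ((psum f M - psum f N) + f M) by ring.
  eapply Rle_trans; [apply Rabs_triang|]. lra.
Qed.

Lemma is_lim_seq_psum (f : nat -> R) (l : R) :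
  is_series f l <-> is_lim_seq (psum f) l.
Proof.
split; intros H.
- apply is_lim_seq_incr_1.
  apply is_lim_seq_ext with (sum_n f); [intros; symmetry; apply psum_sum_n|].
  exact H.
- apply is_lim_seq_incr_1 in H.
  apply is_lim_seq_ext with (v := sum_n f) in H; [exact H|].
  intros; apply psum_sum_n.
Qed.

Lemma is_derive_psum (f df : nat -> R -> R) (N : nat) (x : R) :
  (forall k, (k < N)%nat -> is_derive (f k) x (df k x)) ->
  is_derive (fun y => psum (fun k => f k y) N) x (psum (fun k => df k x) N).
Proof.
induction N as [|N IH]; intros H; simpl.
- apply @is_derive_const.
- refine (is_derive_plus _ (f N) x _ _ (IH _) _); intros; apply H; lia.
Qed.

(** Both [g - f] and [g + f] are nondecreasing. A majorant that varies with the point is what yields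
    1/(N+1) in [alternating_harmonic_error]. *)
Lemma mvt_dominated (f df g dg : R -> R) (a b : R) : a <= b ->
  (forall x, a <= x <= b -> is_derive f x (df x)) ->
  (forall x, a <= x <= b -> is_derive g x (dg x)) ->
  (forall x, a <= x <= b -> Rabs (df x) <= dg x) ->
  Rabs (f b - f a) <= g b - g a.
Proof.
intros Hab Hf Hg H.
assert (Hinc : forall h dh : R -> R, (forall x, a <= x <= b -> is_derive h x (dh x)) ->
  (forall x, a <= x <= b -> 0 <= dh x) -> h a <= h b).
{ intros h dh Hh Hpos. destruct (MVT_gen h a b dh) as [x [Hx E]].
  - rewrite Rmin_left, Rmax_right by lra. intros; apply Hh; lra.
  - rewrite Rmin_left, Rmax_right by lra. intros x Hx.
    apply derivable_continuous_pt. exists (dh x). apply is_derive_Reals, Hh, Hx.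
  - rewrite Rmin_left, Rmax_right in Hx by lra.
    assert (0 <= dh x * (b - a)) by (apply Rmult_le_pos; [apply Hpos, Hx | lra]). lra. }
assert (H1 := Hinc (fun x => g x - f x) (fun x => dg x - df x)).
assert (H2 := Hinc (fun x => g x + f x) (fun x => dg x + df x)).
cbv beta in H1, H2. apply Rabs_le.
assert (g a - f a <= g b - f b).
{ apply H1; intros x Hx.
  - apply (is_derive_minus (V := R_NormedModule)); auto.
  - specialize (H x Hx). apply Rabs_le_between in H. lra. }
assert (g a + f a <= g b + f b).
{ apply H2; intros x Hx.
  - apply (is_derive_plus (V := R_NormedModule)); auto.
  - specialize (H x Hx). apply Rabs_le_between in H. lra. }
lra.
Qed.

Lemma mvt_abs_le (f df : R -> R) (a b e : R) : a <= b ->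
  (forall x, a <= x <= b -> is_derive f x (df x)) ->
  (forall x, a <= x <= b -> Rabs (df x) <= e) ->
  Rabs (f b - f a) <= e * (b - a).
Proof.
intros Hab Hd He. rewrite Rmult_minus_distr_l.
apply (mvt_dominated f df (fun x => e * x) (fun _ => e)); [exact Hab | exact Hd | | exact He].
intros x _. auto_derive; [auto | ring].
Qed.

(** * Sums of inverse powers and zeta at integers *)

Lemma INR_S_pos (n : nat) : 0 < INR (S n).
Proof. apply lt_0_INR; lia. Qed.

Lemma INR_S_ge_1 (n : nat) : 1 <= INR (S n).
Proof. rewrite S_INR. generalize (pos_INR n). lra. Qed.

(** Telescopes, since 1/(M+1)^2 <= 1/(M(M+1)) = 1/M - 1/(M+1). *)
Lemma inv_sq_tail (N M : nat) : (1 <= N <= M)%nat ->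
  psum (fun n => / INR (S n) ^ 2) M - psum (fun n => / INR (S n) ^ 2) N <= / INR N.
Proof.
intros [HN HNM].
assert (H : psum (fun n => / INR (S n) ^ 2) M - psum (fun n => / INR (S n) ^ 2) N
            <= / INR N - / INR M).
{ induction HNM as [|M HNM IH]; [lra|].
  cbn [psum].
  assert (HM : 1 <= INR M) by (apply (le_INR 1); lia).
  assert (/ INR (S M) ^ 2 <= / INR M - / INR (S M)); [|lra].
  rewrite S_INR.
  replace (/ INR M - / (INR M + 1)) with (/ (INR M * (INR M + 1))) by (field; lra).
  apply Rinv_le_contravar; nra. }
assert (0 < / INR M) by (apply Rinv_0_lt_compat, lt_0_INR; lia). lra.
Qed.

Lemma inv_pow_le_sq (m n : nat) : (2 <= m)%nat -> / INR (S n) ^ m <= / INR (S n) ^ 2.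
Proof.
intros Hm. pose proof (INR_S_ge_1 n).
apply Rinv_le_contravar; [apply pow_lt; lra | apply Rle_pow; [lra | lia]].
Qed.

(** The first term is 1 and the tail after it at most 1. This crude 2 is the constant in
    [zeta_bounds] and in [ln_sine_zeta_truncation]. *)
Lemma psum_inv_sq_le_2 (N : nat) : psum (fun n => / INR (S n) ^ 2) N <= 2.
Proof.
destruct N as [|N]; [simpl; lra|].
assert (H := inv_sq_tail 1 (S N) ltac:(lia)).
replace (psum (fun n => / INR (S n) ^ 2) 1) with 1 in H by (simpl; field).
change (INR 1) with 1 in H. lra.
Qed.

Lemma ex_series_inv_pow (m : nat) : (2 <= m)%nat ->
  ex_series (fun n => / INR (S n) ^ m).
Proof.
intros Hm.
destruct (ex_finite_lim_seq_incr (psum (fun n => / INR (S n) ^ m)) 2) as [l Hl].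
- intros n. cbn [psum].
  assert (0 < / INR (S n) ^ m) by (apply Rinv_0_lt_compat, pow_lt, INR_S_pos). lra.
- intros N. eapply Rle_trans; [|apply (psum_inv_sq_le_2 N)].
  apply psum_le. intros; apply inv_pow_le_sq, Hm.
- exists l. apply is_lim_seq_psum, Hl.
Qed.

Lemma zeta_INR (m : nat) : zeta (INR m) = Series (fun n => / INR (S n) ^ m).
Proof.
apply Series_ext. intros n. rewrite Rpower_pow by apply INR_S_pos. reflexivity.
Qed.

Lemma is_lim_seq_zeta (m : nat) : (2 <= m)%nat ->
  is_lim_seq (psum (fun n => / INR (S n) ^ m)) (zeta (INR m)).
Proof.
intros Hm. apply is_lim_seq_psum. rewrite zeta_INR.
apply Series_correct, ex_series_inv_pow, Hm.
Qed.

Lemma zeta_bounds (m : nat) : (2 <= m)%nat -> 0 <= zeta (INR m) <= 2.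
Proof.
intros Hm. split.
- refine (is_lim_seq_le (fun _ => 0) _ 0 _ _ (is_lim_seq_const 0) (is_lim_seq_zeta m Hm)).
  intros N. induction N as [|N IH]; cbn [psum]; [lra|].
  assert (0 < / INR (S N) ^ m) by (apply Rinv_0_lt_compat, pow_lt, INR_S_pos). lra.
- refine (is_lim_seq_le _ (fun _ => 2) _ 2 _ (is_lim_seq_zeta m Hm) (is_lim_seq_const 2)).
  intros N. eapply Rle_trans; [|apply (psum_inv_sq_le_2 N)].
  apply psum_le. intros; apply inv_pow_le_sq, Hm.
Qed.
(** * The product formula for the sine *)

(** The classical Wallis integral is the case a = 0; the factor cos(ax) carries the argument of the
    sine. *)
Definition wallis (a : R) (n : nat) : R :=
  RInt (fun x => cos (a * x) * cos x ^ n) 0 (PI / 2).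

Lemma is_RInt_wallis (a : R) (n : nat) :
  is_RInt (fun x => cos (a * x) * cos x ^ n) 0 (PI / 2) (wallis a n).
Proof.
apply (RInt_correct (V := R_CompleteNormedModule)), ex_RInt_continuous.
intros x _. apply (ex_derive_continuous (V := R_NormedModule)). auto_derive. auto.
Qed.

(* Integrates the derivative of
   m cos(ax) sin x cos^(m-1) x - a sin(ax) cos^m x, with m = n + 2. *)
Lemma wallis_rec (a : R) (n : nat) :
  (INR (S (S n)) ^ 2 - a ^ 2) * wallis a (S (S n)) =
  INR (S (S n)) * INR (S n) * wallis a n.
Proof.
set (m := INR (S (S n))).
set (G := fun x => m * (cos (a * x) * sin x * cos x ^ S n) - a * (sin (a * x) * cos x ^ S (S n))).
set (g := fun x => (m ^ 2 - a ^ 2) * (cos (a * x) * cos x ^ S (S n))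
                   - m * INR (S n) * (cos (a * x) * cos x ^ n)).
assert (H1 : is_RInt g 0 (PI / 2) (G (PI / 2) - G 0)).
{ apply (is_RInt_derive (V := R_CompleteNormedModule) G g).
  - intros x _. unfold G. auto_derive; [auto|].
    unfold g.
    change (match n with O => 1 | S _ => INR n + 1 end) with (INR (S n)).
    assert (Hs : sin x * sin x = 1 - cos x * cos x)
      by (generalize (sin2_cos2 x); unfold Rsqr; lra).
    replace (INR (S n)) with (m - 1) by (unfold m; rewrite (S_INR (S n)); ring).
    fold m.
    rewrite <- !tech_pow_Rmult.
    transitivity (cos (a * x) * cos x ^ n * (m * (cos x * cos x) - m * (m - 1) * (sin x * sin x)
       - a ^ 2 * (cos x * cos x))); [ring|].
    rewrite Hs. ring.
  - intros x _. apply (ex_derive_continuous (V := R_NormedModule)). unfold g. auto_derive. auto. }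
assert (H2 := is_RInt_minus _ _ _ _ _ _
  (is_RInt_scal _ _ _ (m ^ 2 - a ^ 2) _ (is_RInt_wallis a (S (S n))))
  (is_RInt_scal _ _ _ (m * INR (S n)) _ (is_RInt_wallis a n))).
assert (H3 := eq_trans (eq_sym (is_RInt_unique (V := R_CompleteNormedModule) g _ _ _ H1))
  (is_RInt_unique (V := R_CompleteNormedModule) g _ _ _ H2)).
(* Both boundary values of [G] vanish: each term has a positive power of cos x, zero at PI/2, and a
   sine, zero at 0. *)
unfold G in H3. rewrite cos_PI2, Rmult_0_r, sin_0 in H3.
rewrite !pow_ne_zero in H3 by lia.
unfold scal, minus, plus, opp in H3; simpl in H3. unfold mult in H3; simpl in H3.
fold m. unfold m in *. simpl in *. lra.
Qed.

Lemma Rabs_sin_le (x : R) : Rabs (sin x) <= Rabs x.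
Proof.
assert (H : forall y, 0 <= y -> Rabs (sin y) <= y).
{ intros y Hy. replace y with (1 * (y - 0)) at 2 by ring.
  replace (sin y) with (sin y - sin 0) by (rewrite sin_0; ring).
  apply mvt_abs_le with cos; [exact Hy | |].
  - intros; apply is_derive_Reals, derivable_pt_lim_sin.
  - intros z _. apply Rabs_le, COS_bound. }
destruct (Rle_dec 0 x) as [Hx|Hx].
- rewrite (Rabs_pos_eq x) by lra. auto.
- rewrite (Rabs_left x) by lra. rewrite <- Rabs_Ropp, <- sin_neg. apply H. lra.
Qed.

Lemma one_minus_cos_le (y : R) : 1 - cos y <= y ^ 2 / 2.
Proof.
replace (cos y) with (1 - 2 * sin (y / 2) * sin (y / 2))
  by (rewrite <- cos_2a_sin; f_equal; field).
assert (H := Rabs_sin_le (y / 2)). apply Rsqr_le_abs_1 in H. unfold Rsqr in H. nra.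
Qed.

(** The derivative of sin x - x cos x is x sin x >= 0. This trades the factor x^2 cos^2 x in
    [wallis_ratio_bounds] for sin^2 x, which the recurrence can integrate. *)
Lemma x_cos_le_sin (x : R) : 0 <= x <= PI / 2 -> x * cos x <= sin x.
Proof.
intros Hx.
destruct (MVT_gen (fun x => sin x - x * cos x) 0 x (fun x => x * sin x)) as [z [Hz Heq]].
- intros y _. auto_derive; [auto | ring].
- intros y _. apply derivable_continuous_pt. exists (y * sin y). apply is_derive_Reals.
  auto_derive; [auto | ring].
- rewrite Rmin_left, Rmax_right in Hz by lra.
  rewrite sin_0, Rmult_0_l in Heq.
  assert (0 <= sin z) by (apply sin_ge_0; lra).
  assert (0 <= z * sin z * (x - 0)) by (apply Rmult_le_pos; [apply Rmult_le_pos|]; lra).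
  lra.
Qed.

Lemma wallis_0_pos (n : nat) : 0 < wallis 0 n.
Proof.
apply RInt_gt_0; [generalize PI_RGT_0; lra | |].
- intros x Hx. rewrite Rmult_0_l, cos_0, Rmult_1_l. apply pow_lt, cos_gt_0; lra.
- intros x _. apply (ex_derive_continuous (V := R_NormedModule)). auto_derive. auto.
Qed.

(** With m = n + 2, the bounds 1 - cos(ax) <= (ax)^2/2 and x cos x <= sin x reduce the difference of
    the two integrals to a^2/2 times the integral of sin^2 x cos^n x. The latter is
    [wallis 0 n - wallis 0 m], which the recurrence at a = 0 evaluates as
    [wallis 0 m / INR (S n)]. *)
Lemma wallis_ratio_bounds (a : R) (n : nat) :
  0 <= 1 - wallis a (S (S n)) / wallis 0 (S (S n)) <= a ^ 2 / 2 * / INR (S n).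
Proof.
assert (HPI := PI_RGT_0).
assert (H0 := wallis_0_pos (S (S n))).
assert (Hn := INR_S_pos n).
assert (Hrec := wallis_rec 0 n).
set (m := S (S n)) in *.
assert (Hle : wallis a m <= wallis 0 m).
{ refine (is_RInt_le _ _ _ _ _ _ _ (is_RInt_wallis a m) (is_RInt_wallis 0 m) _); [lra|].
  intros x Hx. rewrite Rmult_0_l, cos_0.
  apply Rmult_le_compat_r; [apply pow_le, cos_ge_0; lra | apply COS_bound]. }
assert (Hle2 : wallis 0 m - wallis a m <= a ^ 2 / 2 * (wallis 0 n - wallis 0 m)).
{ assert (H1 := is_RInt_minus _ _ _ _ _ _ (is_RInt_wallis 0 m) (is_RInt_wallis a m)).
  assert (H2 := is_RInt_scal _ _ _ (a ^ 2 / 2) _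
    (is_RInt_minus _ _ _ _ _ _ (is_RInt_wallis 0 n) (is_RInt_wallis 0 m))).
  refine (is_RInt_le _ _ _ _ _ _ _ H1 H2 _); [lra|].
  intros x Hx. unfold scal, minus, plus, opp; simpl. unfold mult; simpl.
  rewrite !Rmult_0_l, cos_0.
  assert (Hc : 0 <= cos x) by (apply cos_ge_0; lra).
  assert (Hp : 0 <= cos x ^ n) by (apply pow_le, Hc).
  assert (Hs : sin x * sin x = 1 - cos x * cos x)
      by (generalize (sin2_cos2 x); unfold Rsqr; lra).
  assert (Hx2 := x_cos_le_sin x ltac:(lra)).
  assert (Hx3 : x * cos x * (x * cos x) <= sin x * sin x).
  { apply Rmult_le_compat; try lra; apply Rmult_le_pos; lra. }
  assert (H1c := one_minus_cos_le (a * x)).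
  apply Rle_trans with ((1 - cos (a * x)) * (cos x * cos x) * cos x ^ n); [right; unfold m; simpl; ring|].
  apply Rle_trans with (a ^ 2 / 2 * (sin x * sin x) * cos x ^ n); [|rewrite Hs; right; unfold m; simpl; field].
  apply Rmult_le_compat_r; [exact Hp|].
  apply Rle_trans with ((a * x) ^ 2 / 2 * (cos x * cos x)).
  - apply Rmult_le_compat_r; nra.
  - apply Rle_trans with (a ^ 2 / 2 * (x * cos x * (x * cos x))); [right; field|].
    apply Rmult_le_compat_l; [nra | exact Hx3]. }
assert (Hn0 : wallis 0 n - wallis 0 m = wallis 0 m / INR (S n)).
{ unfold m in *. rewrite (S_INR (S n)) in Hrec. set (k := INR (S n)) in *.
  apply Rmult_eq_reg_l with ((k + 1) * k); [|nra].
  rewrite Rmult_minus_distr_l, <- Hrec. field. lra. }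
rewrite Hn0 in Hle2.
replace (1 - wallis a m / wallis 0 m) with ((wallis 0 m - wallis a m) / wallis 0 m)
  by (field; lra).
split; [apply Rdiv_le_0_compat; lra|].
apply Rmult_le_reg_r with (wallis 0 m); [exact H0|].
unfold Rdiv at 1. rewrite Rmult_assoc, Rinv_l, Rmult_1_r by lra.
eapply Rle_trans; [exact Hle2 | right; field; lra].
Qed.

(** Quotient of the recurrences for a = 2u and a = 0. As n moves in steps of 2, the 2 in 2u cancels
    and every integer p + 1 occurs. *)
Lemma wallis_ratio_rec (u : R) (p : nat) :
  wallis (2 * u) (2 * p) / wallis 0 (2 * p) =
  (1 - (u / INR (S p)) ^ 2) * (wallis (2 * u) (2 * S p) / wallis 0 (2 * S p)).
Proof.
replace (2 * S p)%nat with (S (S (2 * p))) by lia.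
assert (H1 := wallis_rec (2 * u) (2 * p)).
assert (H2 := wallis_rec 0 (2 * p)).
assert (P1 := wallis_0_pos (2 * p)). assert (P2 := wallis_0_pos (S (S (2 * p)))).
assert (E : INR (S (S (2 * p))) = 2 * INR (S p))
  by (rewrite !S_INR, mult_INR; simpl; ring).
rewrite E in H1, H2. assert (Hp := INR_S_pos p). assert (Hq := INR_S_pos (2 * p)).
set (k := INR (S p)) in *. set (q := INR (S (2 * p))) in *.
set (A := wallis (2 * u) (2 * p)) in *. set (B := wallis 0 (2 * p)) in *.
set (A' := wallis (2 * u) (S (S (2 * p)))) in *. set (B' := wallis 0 (S (S (2 * p)))) in *.
assert (EA : A = (1 - (u / k) ^ 2) * A' * (2 * k / q)).
{ apply Rmult_eq_reg_l with (2 * k * q); [|nra]. rewrite <- H1. field. lra. }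
assert (EB : B = B' * (2 * k / q)).
{ apply Rmult_eq_reg_l with (2 * k * q); [|nra]. rewrite <- H2. field. lra. }
rewrite EA, EB. field. lra.
Qed.

Lemma wallis_2u_0 (u : R) : 0 < u -> wallis (2 * u) 0 / wallis 0 0 = sin (PI * u) / (PI * u).
Proof.
intros Hu. assert (HPI := PI_RGT_0).
assert (E1 : wallis (2 * u) 0 = sin (PI * u) / (2 * u)).
{ apply is_RInt_unique.
  replace (sin (PI * u) / (2 * u)) with
    (minus (sin (2 * u * (PI / 2)) / (2 * u)) (sin (2 * u * 0) / (2 * u))).
  - apply (is_RInt_derive (V := R_CompleteNormedModule) (fun x => sin (2 * u * x) / (2 * u))).
    + intros x _. auto_derive; [auto|]. simpl. field. lra.
    + intros x _. apply (ex_derive_continuous (V := R_NormedModule)). auto_derive. auto.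
  - unfold minus, plus, opp; simpl. rewrite Rmult_0_r, sin_0.
    replace (2 * u * (PI / 2)) with (PI * u) by field. field. lra. }
assert (E2 : wallis 0 0 = PI / 2).
{ unfold wallis. rewrite (RInt_ext _ (fun _ => 1)).
  - rewrite RInt_const. unfold scal; simpl. unfold mult; simpl. ring.
  - intros x _. rewrite Rmult_0_l, cos_0. simpl. ring. }
rewrite E1, E2. field. lra.
Qed.

Lemma sq_div_bounds (u : R) (k : nat) : 0 < u < 1 -> 0 <= (u / INR (S k)) ^ 2 < 1.
Proof.
intros Hu. assert (Hk := INR_S_ge_1 k).
assert (0 < u / INR (S k)) by (apply Rdiv_lt_0_compat; lra).
assert (u / INR (S k) < 1) by (apply Rlt_div_l; lra). nra.
Qed.

(** By [wallis_ratio_rec] the partial product up to p is [Q 0 / Q p], and [Q p] tends to 1. *)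
Lemma is_lim_seq_ln_sine_product (u : R) : 0 < u < 1 ->
  is_lim_seq (psum (fun k => ln (1 - (u / INR (S k)) ^ 2))) (ln (sin (PI * u) / (PI * u))).
Proof.
intros Hu. assert (HPI := PI_RGT_0).
set (Q := fun p => wallis (2 * u) (2 * p) / wallis 0 (2 * p)).
assert (Hsin : 0 < sin (PI * u)) by (apply sin_gt_0; nra).
assert (HQ0 : Q O = sin (PI * u) / (PI * u)) by (unfold Q; rewrite Nat.mul_0_r; apply wallis_2u_0; lra).
assert (Hpos : 0 < Q O) by (rewrite HQ0; apply Rdiv_lt_0_compat; nra).
(* Positivity is carried along because [ln_mult] needs it; it passes from [Q p] to [Q (S p)] since
   the factor between them is positive. *)
assert (H : forall p, 0 < Q p /\
  ln (Q O) = psum (fun k => ln (1 - (u / INR (S k)) ^ 2)) p + ln (Q p)).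
{ induction p as [|p [IH1 IH2]]; [split; [exact Hpos | cbn [psum]; ring]|].
  assert (Hk := sq_div_bounds u p Hu).
  assert (E : Q p = (1 - (u / INR (S p)) ^ 2) * Q (S p)) by (unfold Q; apply wallis_ratio_rec).
  assert (HS : 0 < Q (S p)).
  { destruct (Rle_lt_dec (Q (S p)) 0) as [Hle|]; [|assumption]. exfalso.
    rewrite E in IH1. nra. }
  split; [exact HS|]. rewrite IH2, E, ln_mult by lra. cbn [psum]. ring. }
rewrite <- HQ0.
apply is_lim_seq_ext with (fun p => ln (Q O) - ln (Q p)).
{ intros p. destruct (H p) as [_ ->]. ring. }
replace (Finite (ln (Q O))) with (Finite (ln (Q O) - 0)) by (f_equal; ring).
apply is_lim_seq_minus'; [apply is_lim_seq_const|].
rewrite <- ln_1. apply is_lim_seq_continuous.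
{ apply derivable_continuous_pt. exists (/ 1). apply derivable_pt_lim_ln. lra. }
apply is_lim_seq_incr_1.
assert (Hb : is_lim_seq (fun p => 1 - 2 * u ^ 2 * / INR (S p)) 1).
{ replace (Finite 1) with (Finite (1 - 2 * u ^ 2 * 0)) by (f_equal; ring).
  apply is_lim_seq_minus'; [apply is_lim_seq_const|].
  apply is_lim_seq_scal_l with (lu := 0).
  apply (is_lim_seq_incr_1 (fun n => / INR n)).
  apply (is_lim_seq_inv _ p_infty); [apply is_lim_seq_INR | discriminate]. }
apply is_lim_seq_le_le with (u := fun p => 1 - 2 * u ^ 2 * / INR (S p)) (w := fun _ => 1);
  [|exact Hb | apply is_lim_seq_const].
intros p. unfold Q. replace (2 * S p)%nat with (S (S (2 * p))) by lia.
assert (Hw := wallis_ratio_bounds (2 * u) (2 * p)).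
assert (Hi : / INR (S (2 * p)) <= / INR (S p)).
{ apply Rinv_le_contravar; [apply INR_S_pos | apply le_INR; lia]. }
assert (Hi0 : 0 < / INR (S (2 * p))) by (apply Rinv_0_lt_compat, INR_S_pos).
replace ((2 * u) ^ 2 / 2) with (2 * u ^ 2) in Hw by field.
assert (2 * u ^ 2 * / INR (S (2 * p)) <= 2 * u ^ 2 * / INR (S p))
  by (apply Rmult_le_compat_l; nra).
lra.
Qed.

(** The derivative of the left side is the geometric remainder -z^K/(1-z), at most y^K/(1-y) in
    absolute value on [0, y]. *)
Lemma ln_one_minus_truncation (y : R) (K : nat) : 0 <= y < 1 ->
  Rabs (ln (1 - y) + psum (fun k => y ^ S k / INR (S k)) K) <= y ^ S K / (1 - y).
Proof.
intros Hy.
set (f := fun z => ln (1 - z) + psum (fun k => z ^ S k / INR (S k)) K).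
assert (Hf0 : f 0 = 0).
{ unfold f. rewrite Rminus_0_r, ln_1.
  assert (E : psum (fun k => 0 ^ S k / INR (S k)) K = 0); [|rewrite E; ring].
  clear. induction K as [|K IH]; cbn [psum]; [reflexivity|].
  rewrite IH, pow_ne_zero by lia. unfold Rdiv. ring. }
replace (ln (1 - y) + _) with (f y - f 0) by (rewrite Hf0; unfold f; ring).
replace (y ^ S K / (1 - y)) with (y ^ K / (1 - y) * (y - 0)) by (simpl; field; lra).
apply mvt_abs_le with (fun z => - (z ^ K / (1 - z))); [lra | |].
- intros z Hz. unfold f.
  replace (- (z ^ K / (1 - z))) with (- / (1 - z) + psum (fun k => z ^ k) K).
  + refine (is_derive_plus (fun z => ln (1 - z))
      (fun z => psum (fun k => z ^ S k / INR (S k)) K) z _ _ _ _).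
    * auto_derive; [lra | field; lra].
    * apply (is_derive_psum (fun k z => z ^ S k / INR (S k)) (fun k z => z ^ k)).
      intros k _. assert (Hk := INR_S_pos k).
      auto_derive; [auto|]. change (match k with O => 1 | S _ => INR k + 1 end) with (INR (S k)). field. lra.
  + clear -Hz Hy. induction K as [|K IH]; cbn [psum]; [simpl; field; lra|].
    rewrite <- Rplus_assoc, IH. simpl. field. lra.
- intros z Hz. rewrite Rabs_Ropp.
  assert (0 <= z ^ K) by (apply pow_le; lra).
  assert (z ^ K <= y ^ K) by (apply pow_incr; lra).
  assert (0 < / (1 - z)) by (apply Rinv_0_lt_compat; lra).
  assert (/ (1 - z) <= / (1 - y)) by (apply Rinv_le_contravar; lra).
  unfold Rdiv. rewrite Rabs_pos_eq by (apply Rmult_le_pos; lra).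
  apply Rmult_le_compat; lra.
Qed.

(** Each factor 1 - y of the product, y = u^2/m^2, has its logarithm truncated with error
    y^(K+1)/(1-y). Of the K + 1 powers of y, K give (v^2)^K and the last gives 1/m^2, summable in m.
    The bound by v instead of u makes the estimate uniform in u. *)
Lemma ln_sine_zeta_truncation (u v : R) (K : nat) : 0 < u <= v -> v < 1 ->
  Rabs (ln (sin (PI * u) / (PI * u))
        + psum (fun k => zeta (INR (2 * k + 2)) * u ^ (2 * k + 2) / INR (S k)) K)
  <= 2 / (1 - v ^ 2) * (v ^ 2) ^ K.
Proof.
intros Hu Hv.
set (w := 2 / (1 - v ^ 2) * (v ^ 2) ^ K).
set (F := fun p => psum (fun m => ln (1 - (u / INR (S m)) ^ 2)
            + psum (fun k => ((u / INR (S m)) ^ 2) ^ S k / INR (S k)) K) p).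
assert (HF : forall p, - w <= F p <= w).
{ intros p. apply Rabs_le_between.
  assert (Hw : w = (v ^ 2) ^ K / (1 - v ^ 2) * 2) by (unfold w; field; nra).
  apply Rle_trans with ((v ^ 2) ^ K / (1 - v ^ 2) * psum (fun n => / INR (S n) ^ 2) p).
  2: { rewrite Hw. apply Rmult_le_compat_l; [|apply psum_inv_sq_le_2].
       apply Rdiv_le_0_compat; [apply pow_le|]; nra. }
  rewrite <- psum_scal.
  (* Subtracting an empty sum makes [psum_tail] the triangle inequality for the whole sum. *)
  replace (F p) with (F p - psum (fun m => ln (1 - (u / INR (S m)) ^ 2)
            + psum (fun k => ((u / INR (S m)) ^ 2) ^ S k / INR (S k)) K) 0)
    by (cbn [psum]; ring).
  eapply Rle_trans; [apply psum_tail with (g := fun m => (v ^ 2) ^ K / (1 - v ^ 2) * / INR (S m) ^ 2);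
    [lia|] | cbn [psum]; lra].
  intros m. assert (Hm := INR_S_ge_1 m).
  assert (Hy := sq_div_bounds u m ltac:(lra)).
  eapply Rle_trans; [apply ln_one_minus_truncation, Hy|].
  assert (Hyv : (u / INR (S m)) ^ 2 <= v ^ 2).
  { apply pow_incr. split; [apply Rdiv_le_0_compat; lra|]. apply Rle_div_l; [lra|]. nra. }
  set (y := (u / INR (S m)) ^ 2) in *.
  assert (E : y = u ^ 2 * / INR (S m) ^ 2) by (unfold y; field; lra).
  assert (Hi : 0 < / INR (S m) ^ 2) by (apply Rinv_0_lt_compat, pow_lt; lra).
  assert (Hu2 : u ^ 2 <= 1) by nra.
  assert (Hyi : y <= / INR (S m) ^ 2) by (rewrite E; nra).
  assert (0 <= y ^ K) by (apply pow_le; lra).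
  assert (y ^ K <= (v ^ 2) ^ K) by (apply pow_incr; lra).
  assert (0 < / (1 - y)) by (apply Rinv_0_lt_compat; lra).
  assert (/ (1 - y) <= / (1 - v ^ 2)) by (apply Rinv_le_contravar; nra).
  rewrite <- tech_pow_Rmult. unfold Rdiv.
  replace (y * y ^ K * / (1 - y)) with (y ^ K * / (1 - y) * y) by ring.
  apply Rmult_le_compat; [apply Rmult_le_pos; lra | lra | | exact Hyi].
  apply Rmult_le_compat; lra. }
(* Here K is fixed and only p grows: exchanging two finite sums leaves K partial sums of zeta
   values, each with its own limit. *)
assert (HL : is_lim_seq F (ln (sin (PI * u) / (PI * u))
   + psum (fun k => zeta (INR (2 * k + 2)) * u ^ (2 * k + 2) / INR (S k)) K)).
{ apply is_lim_seq_ext with (fun p => psum (fun m => ln (1 - (u / INR (S m)) ^ 2)) p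
     + psum (fun k => u ^ (2 * k + 2) / INR (S k) * psum (fun m => / INR (S m) ^ (2 * k + 2)) p) K).
  - intros p. unfold F.
    rewrite (psum_ext (fun k => _ * psum _ p)
      (fun k => psum (fun m => ((u / INR (S m)) ^ 2) ^ S k / INR (S k)) p)).
    + rewrite psum_exchange.
      clear. induction p as [|p IH]; cbn [psum]; [ring | rewrite <- IH; ring].
    + intros k _. rewrite <- psum_scal. apply psum_ext. intros m _.
      rewrite <- pow_mult. replace (2 * S k)%nat with (2 * k + 2)%nat by lia.
      unfold Rdiv. rewrite Rpow_mult_distr, pow_inv. field.
      split; [|apply pow_nonzero]; apply not_0_INR; lia.
  - apply is_lim_seq_plus'; [apply is_lim_seq_ln_sine_product; lra|].
    clear. induction K as [|K IH]; cbn [psum]; [apply is_lim_seq_const|].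
    apply is_lim_seq_plus'; [exact IH|].
    replace (zeta _ * _ / _) with (u ^ (2 * K + 2) / INR (S K) * zeta (INR (2 * K + 2)))
      by (unfold Rdiv; ring).
    apply is_lim_seq_scal_l with (lu := zeta (INR (2 * K + 2))), is_lim_seq_zeta. lia. }
apply Rabs_le_between. split.
- refine (is_lim_seq_le (fun _ => - w) F (- w) _ _ (is_lim_seq_const _) HL). apply HF.
- refine (is_lim_seq_le F (fun _ => w) _ w _ HL (is_lim_seq_const _)). apply HF.
Qed.
(** * Partial sums of cos(nt)/n *)

Lemma cos_INR_PI (n : nat) : cos (INR n * PI) = (-1) ^ n.
Proof.
induction n as [|n IH]; [simpl; rewrite Rmult_0_l; apply cos_0|].
rewrite S_INR, Rmult_plus_distr_r, Rmult_1_l, neg_cos, IH. simpl. ring.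
Qed.

(** On [0, 1] the derivative of [f] is (-y)^N/(1+y), dominated by y^N, whose integral is 1/(N+1). *)
Lemma alternating_harmonic_error (N : nat) :
  Rabs (ln 2 + psum (fun k => (-1) ^ S k / INR (S k)) N) <= / INR (S N).
Proof.
set (f := fun y => ln (1 + y) + psum (fun k => (- y) ^ S k / INR (S k)) N).
set (g := fun y => y ^ S N / INR (S N)).
assert (Hf0 : f 0 = 0).
{ unfold f. rewrite Rplus_0_r, ln_1, Ropp_0.
  assert (E : psum (fun k => 0 ^ S k / INR (S k)) N = 0); [|rewrite E; ring].
  clear. induction N as [|N IH]; cbn [psum]; [reflexivity|].
  rewrite IH, pow_ne_zero by lia. unfold Rdiv. ring. }
assert (Hg : g 1 - g 0 = / INR (S N)).
{ unfold g. rewrite pow1, pow_ne_zero by lia. field. apply not_0_INR; lia. }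
rewrite <- Hg.
replace (ln 2 + _) with (f 1 - f 0) by (rewrite Hf0; unfold f; rewrite Rminus_0_r; reflexivity).
apply mvt_dominated with (fun y => (- y) ^ N / (1 + y)) (fun y => y ^ N); [lra | | |].
- intros y Hy. unfold f.
  replace ((- y) ^ N / (1 + y)) with (/ (1 + y) + psum (fun k => - (- y) ^ k) N).
  + refine (is_derive_plus (fun z => ln (1 + z))
      (fun z => psum (fun k => (- z) ^ S k / INR (S k)) N) y _ _ _ _).
    * auto_derive; [lra | field; lra].
    * apply (is_derive_psum (fun k z => (- z) ^ S k / INR (S k)) (fun k z => - (- z) ^ k)).
      intros k _. assert (Hk := INR_S_pos k).
      auto_derive; [auto|].
      change (match k with O => 1 | S _ => INR k + 1 end) with (INR (S k)). field. lra.
  + clear -Hy. induction N as [|N IH]; cbn [psum]; [simpl; field; lra|].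
    rewrite <- Rplus_assoc, IH. simpl. field. lra.
- intros y _. unfold g. assert (Hk := INR_S_pos N).
  auto_derive; [auto|].
  change (match N with O => 1 | S _ => INR N + 1 end) with (INR (S N)). field. lra.
- intros y Hy. unfold Rdiv. rewrite Rabs_mult, <- RPow_abs, Rabs_Ropp.
  rewrite (Rabs_pos_eq y) by lra.
  assert (0 <= y ^ N) by (apply pow_le; lra).
  assert (0 < / (1 + y)) by (apply Rinv_0_lt_compat; lra).
  assert (/ (1 + y) <= 1) by (rewrite <- Rinv_1; apply Rinv_le_contravar; lra).
  rewrite (Rabs_pos_eq (/ (1 + y))) by lra. nra.
Qed.

(** Telescopes through 2 sin(t/2) sin(nt) = cos((n-1/2)t) - cos((n+1/2)t). *)
Lemma sum_sin (t : R) (N : nat) :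
  2 * sin (t / 2) * psum (fun n => sin (INR (S n) * t)) N =
  cos (t / 2) - cos ((INR N + / 2) * t).
Proof.
induction N as [|N IH]; cbn [psum].
- simpl INR. replace ((0 + / 2) * t) with (t / 2) by field. ring.
- rewrite Rmult_plus_distr_l, IH.
  replace ((INR N + / 2) * t) with (INR (S N) * t - t / 2) by (rewrite S_INR; field).
  replace ((INR (S N) + / 2) * t) with (INR (S N) * t + t / 2) by field.
  rewrite cos_minus, cos_plus. ring.
Qed.

(** The function sin(t/2) increases up to PI and is symmetric about it, so its minimum is at the
    ends. *)
Lemma sin_half_ge (d t : R) : 0 < d <= PI -> d <= t <= 2 * PI - d ->
  0 < sin (d / 2) <= sin (t / 2).
Proof.
intros Hd Ht. assert (HPI := PI_RGT_0).
split; [apply sin_gt_0; lra|].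
destruct (Rle_dec t PI).
- apply sin_incr_1; lra.
- replace (sin (d / 2)) with (sin (PI - d / 2)) by apply sin_PI_x.
  apply sin_decr_1; lra.
Qed.

(* Subtracting sin((N+1/2)t) / ((2N+1) sin(t/2)), which is [E] below, leaves a
   function whose derivative is O(1/N), because sum sin(nt) is given by the
   Dirichlet kernel; the constant is fixed at t = PI by the alternating harmonic series. *)
Lemma sum_cos_log_sine (d : R) : 0 < d <= PI ->
  exists C, forall N t, d <= t <= 2 * PI - d ->
  Rabs (psum (fun n => cos (INR (S n) * t) / INR (S n)) N + ln (2 * sin (t / 2)))
  <= C * / INR (S N).
Proof.
intros Hd. assert (HPI := PI_RGT_0).
set (m := sin (d / 2)).
assert (Hm : 0 < m) by (apply sin_gt_0; lra).
(* The 2 pays for [L PI] and [E PI], [/ m] for [E t], and the last term for a slope of at most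
   i/(2m^2) over a length bounded by 2 PI. *)
exists (2 + / m + PI * / m ^ 2). intros N t Ht.
set (q := 2 * INR N + 1).
set (E := fun x => sin ((INR N + / 2) * x) * / (q * sin (x / 2))).
set (L := fun x => psum (fun n => cos (INR (S n) * x) / INR (S n)) N + ln (2 * sin (x / 2))).
set (dR := fun x => sin ((INR N + / 2) * x) * cos (x / 2) * / (2 * q * sin (x / 2) ^ 2)).
set (i := / INR (S N)).
assert (Hi : 0 < i) by (apply Rinv_0_lt_compat, INR_S_pos).
assert (Hq1 : 1 <= q) by (unfold q; generalize (pos_INR N); lra).
assert (Hq : 0 < / q <= i).
{ split; [apply Rinv_0_lt_compat; lra|].
  apply Rinv_le_contravar; [apply INR_S_pos | unfold q; rewrite S_INR; generalize (pos_INR N); lra]. }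
assert (HE : forall x, d <= x <= 2 * PI - d -> Rabs (E x) <= i * / m).
{ intros x Hx. destruct (sin_half_ge d x Hd Hx) as [_ Hs]. fold m in Hs.
  unfold E. rewrite Rabs_mult, Rinv_mult, Rabs_mult.
  rewrite (Rabs_pos_eq (/ q)), (Rabs_pos_eq (/ sin (x / 2)))
    by (left; try apply Rinv_0_lt_compat; lra).
  assert (Rabs (sin ((INR N + / 2) * x)) <= 1) by apply Rabs_le, SIN_bound.
  assert (/ sin (x / 2) <= / m) by (apply Rinv_le_contravar; lra).
  assert (0 < / sin (x / 2)) by (apply Rinv_0_lt_compat; lra).
  rewrite <- (Rmult_1_l (i * / m)).
  apply Rmult_le_compat; [apply Rabs_pos | apply Rmult_le_pos; lra | lra |].
  apply Rmult_le_compat; lra. }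
assert (HdR : forall x, d <= x <= 2 * PI - d ->
  is_derive (fun y => L y - E y) x (dR x) /\ Rabs (dR x) <= i * / m ^ 2 / 2).
{ intros x Hx. destruct (sin_half_ge d x Hd Hx) as [_ Hs]. fold m in Hs.
  split.
  - replace (dR x) with ((psum (fun n => - sin (INR (S n) * x)) N + cos (x / 2) / (2 * sin (x / 2)))
      - ((INR N + / 2) * cos ((INR N + / 2) * x) * / (q * sin (x / 2)) - dR x)).
    + refine (is_derive_minus L E x _ _ _ _).
      * refine (is_derive_plus (fun y => psum (fun n => cos (INR (S n) * y) / INR (S n)) N)
         (fun y => ln (2 * sin (y / 2))) x _ _ _ _).
        -- apply (is_derive_psum (fun n y => cos (INR (S n) * y) / INR (S n))
             (fun n y => - sin (INR (S n) * y))).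
           intros k _. assert (Hk := INR_S_pos k). set (kk := INR (S k)) in *.
           auto_derive; [auto | field; lra].
        -- auto_derive; [unfold Rdiv in *; lra | unfold Rdiv; field; unfold Rdiv in *; lra].
      * unfold E. auto_derive; [unfold Rdiv in *; nra|].
        unfold dR, q. unfold q in Hq1. unfold Rdiv in *. field. lra.
    (* By [sum_sin] the derivative of [L] is cos((N+1/2)x)/(2 sin(x/2)), as the half-angle
       cotangents cancel. Since q = 2(N+1/2), this is also the leading part of the derivative of
       [E]; only [dR] remains. *)
    + assert (Hsum := sum_sin x N).
      assert (Hneg : psum (fun n => - sin (INR (S n) * x)) N = - psum (fun n => sin (INR (S n) * x)) N).
      { rewrite <- (Rmult_1_l (psum (fun n => sin _) N)), Ropp_mult_distr_l, <- psum_scal.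
        apply psum_ext; intros; ring. }
      rewrite Hneg.
      replace (psum (fun n => sin (INR (S n) * x)) N) with
        ((cos (x / 2) - cos ((INR N + / 2) * x)) / (2 * sin (x / 2)))
        by (rewrite <- Hsum; field; lra).
      unfold q. unfold q in Hq1. field. lra.
  - unfold dR. rewrite Rabs_mult, Rabs_mult.
    assert (H1 : Rabs (sin ((INR N + / 2) * x)) <= 1) by apply Rabs_le, SIN_bound.
    assert (H2 : Rabs (cos (x / 2)) <= 1) by apply Rabs_le, COS_bound.
    assert (H3 : m ^ 2 <= sin (x / 2) ^ 2) by (apply pow_incr; lra).
    assert (H4 : 0 < m ^ 2) by (apply pow_lt; lra).
    replace (/ (2 * q * sin (x / 2) ^ 2)) with (/ q * / (sin (x / 2) ^ 2) / 2)
      by (field; lra).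
    assert (H5 : / sin (x / 2) ^ 2 <= / m ^ 2) by (apply Rinv_le_contravar; lra).
    assert (H6 : 0 < / sin (x / 2) ^ 2) by (apply Rinv_0_lt_compat; lra).
    rewrite (Rabs_pos_eq (/ q * _ / 2)) by (apply Rmult_le_pos; [apply Rmult_le_pos|]; lra).
    apply Rle_trans with (1 * 1 * (/ q * / sin (x / 2) ^ 2 / 2)).
    + apply Rmult_le_compat_r; [apply Rmult_le_pos; [apply Rmult_le_pos|]; lra|].
      apply Rmult_le_compat; try apply Rabs_pos; assumption.
    + rewrite !Rmult_1_l. unfold Rdiv. apply Rmult_le_compat_r; [lra|].
      apply Rmult_le_compat; lra. }
assert (Hmid : Rabs (L PI) <= i).
{ unfold L. rewrite sin_PI2, Rmult_1_r, Rplus_comm.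
  rewrite (psum_ext _ (fun k => (-1) ^ S k / INR (S k)))
    by (intros; rewrite cos_INR_PI; reflexivity).
  apply alternating_harmonic_error. }
assert (Hend : Rabs (E PI) <= i).
{ unfold E. rewrite sin_PI2, Rmult_1_r, Rabs_mult, (Rabs_pos_eq (/ q)) by lra.
  assert (Rabs (sin ((INR N + / 2) * PI)) <= 1) by apply Rabs_le, SIN_bound. nra. }
assert (Hm2 : 0 < / m ^ 2) by (apply Rinv_0_lt_compat, pow_lt; lra).
assert (Hmvt : Rabs ((L t - E t) - (L PI - E PI)) <= i * / m ^ 2 / 2 * (2 * PI)).
{ assert (H0 : 0 < i * / m ^ 2 / 2) by nra.
  destruct (Rle_dec t PI).
  - rewrite Rabs_minus_sym.
    eapply Rle_trans; [apply (mvt_abs_le (fun x => L x - E x) dR t PI (i * / m ^ 2 / 2))|]; try lra;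
      [| |apply Rmult_le_compat_l; lra]; intros; apply HdR; lra.
  - eapply Rle_trans; [apply (mvt_abs_le (fun x => L x - E x) dR PI t (i * / m ^ 2 / 2))|]; try lra;
      [| |apply Rmult_le_compat_l; lra]; intros; apply HdR; lra. }
specialize (HE t Ht).
change (Rabs (L t) <= (2 + / m + PI * / m ^ 2) * i).
replace (L t) with ((L t - E t - (L PI - E PI)) + E t + L PI + - E PI) by ring.
eapply Rle_trans; [apply Rabs_triang|].
eapply Rle_trans; [apply Rplus_le_compat_r; eapply Rle_trans; [apply Rabs_triang|];
  apply Rplus_le_compat_r, Rabs_triang|].
rewrite Rabs_Ropp. nra.
Qed.
(** * Iterated integration *)

(** Divided powers: differentiation lowers the index and creates no factor. *)
Definition mono (m : nat) (t : R) : R := t ^ m / INR (fact m).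

(* The phase j PI/2 makes [trig_sum j N] the derivative of [trig_sum (S j) N]
   for both parities, without signs. *)
Definition trig_sum (j N : nat) (t : R) : R :=
  psum (fun n => cos (INR (S n) * t - INR j * (PI / 2)) / INR (S n) ^ (S j)) N.

(* The polynomial of the theorem with zeta truncated at [N], so that
   [defect (S j) N] tends to exactly 0 at 0+. *)
Definition taylor_part (j N : nat) (t : R) : R :=
  psum (fun k => trig_sum (j - k) N 0 * mono k t) j.

(** The j-fold primitive of -ln t that vanishes at 0+ at each step; every integration by parts adds
    one 1/i to the harmonic number. *)
Definition log_part (j : nat) (t : R) : R := mono j t * (harmonic j - ln t).

(* Indexed from 0: [zeta_coef k] belongs to zeta(2(k+1)). *)
Definition zeta_coef (k : nat) : R :=
  2 * zeta (INR (2 * k + 2)) * INR (fact (2 * k + 1)) / (2 * PI) ^ (2 * k + 2).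

Definition zeta_sum (j N : nat) (t : R) : R :=
  psum (fun k => zeta_coef k * mono (j + (2 * k + 2)) t) N.

Definition defect (j N : nat) (t : R) : R :=
  trig_sum j N t - taylor_part j N t - log_part j t - zeta_sum j N t.

Lemma mono_0 (t : R) : mono 0 t = 1.
Proof. unfold mono. simpl. field. Qed.

Lemma mono_S_0 (m : nat) : mono (S m) 0 = 0.
Proof. unfold mono. rewrite pow_ne_zero by lia. unfold Rdiv. ring. Qed.

Lemma mono_S (m : nat) (t : R) : mono (S m) t = t * mono m t / INR (S m).
Proof.
unfold mono. rewrite fact_simpl, mult_INR. simpl pow. field.
split; [apply INR_fact_neq_0 | apply not_0_INR; lia].
Qed.

Lemma is_derive_mono (m : nat) (t : R) : is_derive (mono (S m)) t (mono m t).
Proof.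
unfold mono. rewrite fact_simpl, mult_INR.
assert (H1 := INR_S_pos m). assert (H2 := INR_fact_lt_0 m).
set (k := INR (S m)) in *.
auto_derive; [auto|].
change (match m with O => 1 | S _ => INR m + 1 end) with (INR (S m)). fold k. field. lra.
Qed.

Lemma is_derive_trig_sum (j N : nat) (t : R) :
  is_derive (trig_sum (S j) N) t (trig_sum j N t).
Proof.
apply (is_derive_psum (fun n t => cos (INR (S n) * t - INR (S j) * (PI / 2)) / INR (S n) ^ (S (S j)))
  (fun n t => cos (INR (S n) * t - INR j * (PI / 2)) / INR (S n) ^ (S j))).
intros n _. assert (Hn := INR_S_pos n). rewrite (S_INR j).
set (k := INR (S n)) in *.
assert (E : cos (k * t - INR j * (PI / 2)) = - sin (k * t - (INR j + 1) * (PI / 2))).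
{ replace (k * t - (INR j + 1) * (PI / 2)) with (k * t - INR j * (PI / 2) - PI / 2) by ring.
  rewrite (sin_minus _ (PI / 2)), cos_PI2, sin_PI2. ring. }
rewrite E. cbn [pow]. assert (Hp : 0 < k ^ j) by (apply pow_lt; lra).
auto_derive; [auto|]. unfold Rminus, Rdiv. field. lra.
Qed.

Lemma is_derive_taylor_part (j N : nat) (t : R) :
  is_derive (taylor_part (S j) N) t (taylor_part j N t).
Proof.
apply is_derive_ext with (fun t => trig_sum (S j) N 0
  + psum (fun k => trig_sum (j - k) N 0 * mono (S k) t) j).
{ intros s. unfold taylor_part. rewrite psum_Sl, mono_0, Nat.sub_0_r.
  rewrite Rmult_1_r. reflexivity. }
rewrite <- (Rplus_0_l (taylor_part j N t)).
apply (is_derive_plus (V := R_NormedModule)); [apply @is_derive_const|].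
apply (is_derive_psum (fun k t => trig_sum (j - k) N 0 * mono (S k) t)
  (fun k t => trig_sum (j - k) N 0 * mono k t)).
intros k _. apply is_derive_scal, is_derive_mono.
Qed.

Lemma is_derive_zeta_sum (j N : nat) (t : R) :
  is_derive (zeta_sum (S j) N) t (zeta_sum j N t).
Proof.
apply (is_derive_psum (fun k t => zeta_coef k * mono (S (j + (2 * k + 2))) t)
  (fun k t => zeta_coef k * mono (j + (2 * k + 2)) t)).
intros k _. apply is_derive_scal, is_derive_mono.
Qed.

Lemma harmonic_0 : harmonic 0 = 0.
Proof. unfold harmonic. rewrite sum_n_m_zero by lia. reflexivity. Qed.

Lemma harmonic_S (j : nat) : harmonic (S j) = harmonic j + / INR (S j).
Proof. unfold harmonic. rewrite sum_n_Sm by lia. reflexivity. Qed.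

(** Differentiating the logarithm gives -t^j/(j+1)!, that is [- mono j t / INR (S j)], which lowers
    [harmonic (S j)] to [harmonic j]. *)
Lemma is_derive_log_part (j : nat) (t : R) : 0 < t ->
  is_derive (log_part (S j)) t (log_part j t).
Proof.
intros Ht. unfold log_part.
replace (mono j t * (harmonic j - ln t)) with
  (mono j t * (harmonic (S j) - ln t) + mono (S j) t * - / t).
- apply (is_derive_mult (mono (S j)) (fun t => harmonic (S j) - ln t) t).
  + apply is_derive_mono.
  + auto_derive; [lra | field; lra].
  + intros; apply Rmult_comm.
- rewrite harmonic_S, mono_S. assert (H := INR_S_pos j). field. lra.
Qed.

Lemma is_derive_defect (j N : nat) (t : R) : 0 < t ->
  is_derive (defect (S j) N) t (defect j N t).
Proof.
intros Ht. unfold defect.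
repeat apply (is_derive_minus (V := R_NormedModule)).
- apply is_derive_trig_sum.
- apply is_derive_taylor_part.
- apply is_derive_log_part, Ht.
- apply is_derive_zeta_sum.
Qed.

(** * One-sided limits at the end points *)

Lemma filterlim_Rminus {T : Type} (F : (T -> Prop) -> Prop) {FF : Filter F}
  (f g : T -> R) (a b : R) :
  filterlim f F (locally a) -> filterlim g F (locally b) ->
  filterlim (fun x => f x - g x) F (locally (a - b)).
Proof.
intros Hf Hg. apply filterlim_comp_2 with (1 := Hf) (h := Rplus) (g := fun x => - g x)
  (2 := filterlim_comp _ _ _ _ _ _ _ _ Hg (filterlim_opp (V := R_NormedModule) b)).
apply (filterlim_plus (V := R_NormedModule)).
Qed.

(** Substitute y = ln t in y exp(y), which tends to 0 at minus infinity. *)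
Lemma filterlim_x_ln_x : filterlim (fun t => t * ln t) (at_right 0) (locally 0).
Proof.
apply (filterlim_within_ext (fun t => 0 < t) (fun t => ln t * exp (ln t))).
- intros t Ht. rewrite exp_ln by exact Ht. ring.
- apply (filterlim_comp _ _ _ ln (fun y => y * exp y) (at_right 0) _ (locally 0) is_lim_ln_0).
  exact is_lim_mul_exp_m.
Qed.

Lemma filterlim_derive_at_right (f : R -> R) (df a : R) :
  is_derive f a df -> filterlim f (at_right a) (locally (f a)).
Proof.
intros H. apply (filterlim_filter_le_1 f (filter_le_within (F := locally a) _)).
apply (ex_derive_continuous (V := R_NormedModule)). exists df. exact H.
Qed.

Lemma filterlim_derive_at_left (f : R -> R) (df a : R) :
  is_derive f a df -> filterlim f (at_left a) (locally (f a)).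
Proof.
intros H. apply (filterlim_filter_le_1 f (filter_le_within (F := locally a) _)).
apply (ex_derive_continuous (V := R_NormedModule)). exists df. exact H.
Qed.

Lemma filterlim_log_part (j : nat) : filterlim (log_part (S j)) (at_right 0) (locally 0).
Proof.
(* One factor t, present from level 1 on, is set against ln t. *)
apply filterlim_ext with (fun t => mono j t * / INR (S j) * (harmonic (S j) * t - t * ln t)).
{ intros t. unfold log_part. rewrite mono_S. unfold Rdiv. ring. }
set (h := harmonic (S j)).
replace 0 with (mono j 0 * / INR (S j) * (h * 0 - 0)) at 2 by ring.
refine (filterlim_comp_2 _ _ Rmult _ _ (filterlim_mult (K := R_AbsRing) _ _)).
- apply (filterlim_derive_at_right (fun t => mono j t * / INR (S j))
    (INR j * 0 ^ pred j / INR (fact j) * / INR (S j))).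
  unfold mono. assert (H1 := INR_S_pos j). assert (H2 := INR_fact_lt_0 j).
  set (k := INR (S j)) in *.
  auto_derive; [auto|]. field. lra.
- apply (filterlim_Rminus (at_right 0)); [| apply filterlim_x_ln_x].
  apply (filterlim_derive_at_right (fun t => h * t) h). auto_derive; [auto | ring].
Qed.

Lemma taylor_part_S_0 (j N : nat) : taylor_part (S j) N 0 = trig_sum (S j) N 0.
Proof.
unfold taylor_part. rewrite psum_Sl, mono_0, Nat.sub_0_r.
rewrite (psum_ext _ (fun _ => 0 * 0)) by (intros; rewrite mono_S_0; ring).
rewrite psum_scal. ring.
Qed.

Lemma zeta_sum_0 (j N : nat) : zeta_sum j N 0 = 0.
Proof.
unfold zeta_sum. rewrite (psum_ext _ (fun _ => 0 * 0)).
- rewrite psum_scal. ring.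
- intros k _. replace (j + (2 * k + 2))%nat with (S (j + (2 * k + 1))) by lia.
  rewrite mono_S_0. ring.
Qed.

Lemma filterlim_defect (j N : nat) : filterlim (defect (S j) N) (at_right 0) (locally 0).
Proof.
unfold defect.
replace 0 with (trig_sum (S j) N 0 - taylor_part (S j) N 0 - 0 - zeta_sum (S j) N 0) at 2
  by (rewrite taylor_part_S_0, zeta_sum_0; ring).
repeat apply (filterlim_Rminus (at_right 0)).
- eapply filterlim_derive_at_right, is_derive_trig_sum.
- eapply filterlim_derive_at_right, is_derive_taylor_part.
- apply filterlim_log_part.
- eapply filterlim_derive_at_right, is_derive_zeta_sum.
Qed.

Lemma filterlim_Rabs_le (F : (R -> Prop) -> Prop) {FF : ProperFilter F}
  (f : R -> R) (l e : R) :
  filterlim f F (locally l) -> F (fun x => Rabs (f x) <= e) -> Rabs l <= e.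
Proof.
intros Hf He. apply Rabs_le. split.
- apply (filterlim_le (F := F) (fun _ => - e) f (- e) l).
  + revert He. apply filter_imp. intros x Hx. apply Rabs_le_between in Hx. lra.
  + apply filterlim_const.
  + exact Hf.
- apply (filterlim_le (F := F) f (fun _ => e) l e).
  + revert He. apply filter_imp. intros x Hx. apply Rabs_le_between in Hx. lra.
  + exact Hf.
  + apply filterlim_const.
Qed.

Lemma at_right_between (a b : R) : a < b -> at_right a (fun x => a < x < b).
Proof.
intros Hab. exists (mkposreal (b - a) (proj2 (Rlt_0_minus _ _) Hab)). simpl.
intros y Hy Hlt. apply Rabs_lt_between' in Hy. lra.
Qed.

Lemma at_left_between (a b : R) : a < b -> at_left b (fun x => a < x < b).
Proof.
intros Hab. exists (mkposreal (b - a) (proj2 (Rlt_0_minus _ _) Hab)). simpl.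
intros y Hy Hlt. apply Rabs_lt_between' in Hy. lra.
Qed.

(** * Bounds on the defect *)

(** The derivative is available only at positive points, so the mean value inequality is applied on
    [s, t] and s then tends to 0. *)
Lemma defect_S_bound (j N : nat) (b e : R) : 0 <= e ->
  (forall t, 0 < t <= b -> Rabs (defect j N t) <= e) ->
  forall t, 0 < t <= b -> Rabs (defect (S j) N t) <= e * b.
Proof.
intros He H t Ht.
rewrite <- (Rminus_0_r (defect (S j) N t)).
apply (filterlim_Rabs_le (at_right 0) (fun s => defect (S j) N t - defect (S j) N s)).
- apply (filterlim_Rminus (at_right 0) (fun _ => defect (S j) N t) (defect (S j) N)); [apply filterlim_const | apply filterlim_defect].
- apply filter_imp with (2 := at_right_between 0 t (proj1 Ht)).
  intros s Hs.
  eapply Rle_trans; [apply mvt_abs_le with (df := defect j N) (e := e); [lra | |]|].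
  + intros x Hx. apply is_derive_defect. lra.
  + intros x Hx. apply H. lra.
  + apply Rmult_le_compat_l; lra.
Qed.

(** Since 2 (2k+1)!/(2k+2)! = 1/(k+1), level 0 takes the form of [ln_sine_zeta_truncation] with u =
    t/(2 PI). *)
Lemma zeta_sum_0_eq (N : nat) (t : R) : 0 < t ->
  zeta_sum 0 N t =
  psum (fun k => zeta (INR (2 * k + 2)) * (t / (2 * PI)) ^ (2 * k + 2) / INR (S k)) N.
Proof.
intros Ht. assert (HPI := PI_RGT_0). apply psum_ext. intros k _.
unfold zeta_coef, mono. rewrite Nat.add_0_l.
replace (2 * k + 2)%nat with (S (2 * k + 1)) by lia.
rewrite fact_simpl, mult_INR.
assert (E : INR (S (2 * k + 1)) = 2 * INR (S k))
  by (rewrite !S_INR, plus_INR, mult_INR; simpl; ring).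
assert (Ep : forall n, (t / (2 * PI)) ^ n = t ^ n / (2 * PI) ^ n)
  by (intros n; unfold Rdiv; rewrite Rpow_mult_distr, pow_inv; reflexivity).
rewrite E, Ep. field.
repeat split; first [apply INR_fact_neq_0 | apply pow_nonzero; lra | apply not_0_INR; lia].
Qed.

(** Both halves are compared with ln(2 sin(t/2)). The number v is the value of u = t/(2 PI) at the
    right end 2 PI - d, so the geometric rate v^2 stays below 1 for fixed d. *)
Lemma defect_0_tendsto (d : R) : 0 < d <= PI ->
  exists e, is_lim_seq e 0 /\
  forall N t, d <= t <= 2 * PI - d -> Rabs (defect 0 N t) <= e N.
Proof.
intros Hd. assert (HPI := PI_RGT_0).
destruct (sum_cos_log_sine d Hd) as [C HC].
set (v := (2 * PI - d) / (2 * PI)).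
assert (Hv : 0 < v < 1) by (split; [apply Rdiv_lt_0_compat | apply Rlt_div_l]; lra).
exists (fun N => C * / INR (S N) + 2 / (1 - v ^ 2) * (v ^ 2) ^ N). split.
- replace (Finite 0) with (Finite (C * 0 + 2 / (1 - v ^ 2) * 0)) by (f_equal; ring).
  apply is_lim_seq_plus'.
  + apply is_lim_seq_scal_l with (lu := 0), (is_lim_seq_incr_1 (fun n => / INR n)).
    apply (is_lim_seq_inv _ p_infty); [apply is_lim_seq_INR | discriminate].
  + apply is_lim_seq_scal_l with (lu := 0), is_lim_seq_geom.
    rewrite Rabs_pos_eq; nra.
- intros N t Ht.
  set (u := t / (2 * PI)).
  assert (Hu : 0 < u <= v).
  { split; [apply Rdiv_lt_0_compat; lra|].
    unfold u, v, Rdiv. apply Rmult_le_compat_r; [left; apply Rinv_0_lt_compat|]; lra. }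
  assert (HZ := ln_sine_zeta_truncation u v N Hu (proj2 Hv)).
  assert (EZ := zeta_sum_0_eq N t ltac:(lra)). fold u in EZ. rewrite <- EZ in HZ.
  assert (Hs := sin_half_ge d t Hd Ht).
  replace (PI * u) with (t / 2) in HZ by (unfold u; field; lra).
  replace (sin (t / 2) / (t / 2)) with (2 * sin (t / 2) / t) in HZ by (field; lra).
  unfold Rdiv at 1 in HZ.
  rewrite ln_mult, ln_Rinv in HZ; [| lra | lra | apply Rinv_0_lt_compat; lra].
  replace (defect 0 N t) with
    (psum (fun n => cos (INR (S n) * t) / INR (S n)) N + ln (2 * sin (t / 2))
     - (ln (2 * sin (t / 2)) + - ln t + zeta_sum 0 N t)).
  + eapply Rle_trans; [apply Rabs_triang|]. rewrite Rabs_Ropp.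
    apply Rplus_le_compat; [apply HC, Ht | exact HZ].
  + unfold defect, log_part, taylor_part. rewrite mono_0, harmonic_0. cbn [psum].
    replace (trig_sum 0 N t) with (psum (fun n => cos (INR (S n) * t) / INR (S n)) N).
    * ring.
    * apply psum_ext. intros n _. simpl (INR 0). rewrite Rmult_0_l, Rminus_0_r, pow_1.
      reflexivity.
Qed.

Lemma trig_sum_1_tail (N M : nat) (t : R) : (1 <= N <= M)%nat ->
  Rabs (trig_sum 1 M t - trig_sum 1 N t) <= / INR N.
Proof.
intros H. eapply Rle_trans; [|apply inv_sq_tail, H].
apply psum_tail; [lia|]. intros k.
assert (Hk : 0 < INR (S k) ^ 2) by apply pow_lt, INR_S_pos.
unfold Rdiv. rewrite Rabs_mult, (Rabs_pos_eq (/ _)) by (left; apply Rinv_0_lt_compat, Hk).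
rewrite <- (Rmult_1_l (/ INR (S k) ^ 2)) at 2.
apply Rmult_le_compat_r; [left; apply Rinv_0_lt_compat, Hk | apply Rabs_le, COS_bound].
Qed.

(** The quotient (2k+1)!/(2k+3)! is at most 1/(4(k+1)^2), and the powers of t contribute at most 2
    PI even at t = 2 PI. With zeta <= 2 each term is at most 2 PI/(k+1)^2. *)
Lemma zeta_sum_1_tail (N M : nat) (t : R) : (1 <= N <= M)%nat -> 0 <= t <= 2 * PI ->
  Rabs (zeta_sum 1 M t - zeta_sum 1 N t) <= 2 * PI * / INR N.
Proof.
intros H Ht.
apply Rle_trans with (2 * PI * (psum (fun n => / INR (S n) ^ 2) M - psum (fun n => / INR (S n) ^ 2) N)).
2: { apply Rmult_le_compat_l; [lra | apply inv_sq_tail, H]. }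
rewrite Rmult_minus_distr_l, <- !psum_scal.
apply psum_tail; [lia|]. intros k.
destruct (zeta_bounds (2 * k + 2) ltac:(lia)) as [Hz0 Hz].
assert (E : zeta_coef k * mono (1 + (2 * k + 2)) t =
  (2 * zeta (INR (2 * k + 2))) * (t ^ (2 * k + 3) / (2 * PI) ^ (2 * k + 2))
   * / (INR (2 * k + 3) * INR (2 * k + 2))).
{ unfold zeta_coef, mono. change (1 + (2 * k + 2))%nat with (S (2 * k + 2)).
  rewrite fact_simpl, mult_INR. replace (fact (2 * k + 2)) with ((2 * k + 2) * fact (2 * k + 1))%nat
    by (replace (2 * k + 2)%nat with (S (2 * k + 1)) by lia; rewrite fact_simpl; lia).
  rewrite mult_INR. replace (S (2 * k + 2)) with (2 * k + 3)%nat by lia.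
  field. assert (HPI := PI_RGT_0).
  repeat split; try apply pow_nonzero; try apply INR_fact_neq_0; try lra; apply not_0_INR; lia. }
rewrite E.
assert (HPI := PI_RGT_0).
assert (Hp : 0 < (2 * PI) ^ (2 * k + 2)) by (apply pow_lt; lra).
assert (H1 : 0 <= t ^ (2 * k + 3) / (2 * PI) ^ (2 * k + 2) <= 2 * PI).
{ split; [apply Rdiv_le_0_compat; [apply pow_le; lra | exact Hp]|].
  apply Rle_div_l; [exact Hp|]. rewrite tech_pow_Rmult.
  replace (S (2 * k + 2)) with (2 * k + 3)%nat by lia. apply pow_incr; lra. }
assert (Hk := INR_S_pos k).
assert (H2 : 0 < / (INR (2 * k + 3) * INR (2 * k + 2)) <= / 4 * / INR (S k) ^ 2).
{ assert (E2 : INR (2 * k + 2) = 2 * INR (S k))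
    by (rewrite S_INR, plus_INR, mult_INR; simpl; ring).
  assert (E3 : INR (2 * k + 3) = 2 * INR (S k) + 1)
    by (rewrite S_INR, plus_INR, mult_INR; simpl; ring).
  rewrite E2, E3. split; [apply Rinv_0_lt_compat; nra|].
  rewrite <- Rinv_mult. apply Rinv_le_contravar; nra. }
rewrite Rabs_pos_eq by (apply Rmult_le_pos; [apply Rmult_le_pos|]; lra).
replace (2 * PI * / INR (S k) ^ 2) with (4 * (2 * PI) * (/ 4 * / INR (S k) ^ 2)) by (field; lra).
apply Rmult_le_compat; [apply Rmult_le_pos; lra | lra | | lra].
apply Rmult_le_compat; lra.
Qed.

(** [log_part] does not depend on the truncation and cancels. The constant adds 1 for [trig_sum] at
    t, 1 for [trig_sum] at 0 and 2 PI for [zeta_sum]. *)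
Lemma defect_1_tail (N M : nat) (t : R) : (1 <= N <= M)%nat -> 0 <= t <= 2 * PI ->
  Rabs (defect 1 M t - defect 1 N t) <= (2 + 2 * PI) * / INR N.
Proof.
intros H Ht.
assert (H1 := trig_sum_1_tail N M t H).
assert (H2 := trig_sum_1_tail N M 0 H).
assert (H3 := zeta_sum_1_tail N M t H Ht).
assert (E : forall K, taylor_part 1 K t = trig_sum 1 K 0)
  by (intros K; unfold taylor_part; cbn [psum]; rewrite mono_0; simpl Nat.sub; ring).
unfold defect. rewrite !E.
apply Rabs_le_between in H1, H2, H3. apply Rabs_le. split; lra.
Qed.

(* [defect 1 M t - defect 1 M s] tends to [0] as [M] grows, while [defect 1 N s]
   tends to [0] with [s]: this determines [defect 1 N t] up to two tails. *)
Lemma defect_1_bound (N : nat) (t : R) : (1 <= N)%nat -> 0 < t <= 2 * PI ->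
  Rabs (defect 1 N t) <= 2 * ((2 + 2 * PI) * / INR N).
Proof.
intros HN. assert (HPI := PI_RGT_0).
set (w := (2 + 2 * PI) * / INR N).
assert (Hst : forall s t, 0 < s < t -> t < 2 * PI -> Rabs (defect 1 N t - defect 1 N s) <= 2 * w).
{ clear t. intros s t Hs Ht.
  (* The largest margin with [s, t] inside [d, 2 PI - d]; it is at most PI because s < t. *)
  set (d := Rmin s (2 * PI - t)).
  assert (Hd : 0 < d <= PI).
  { unfold d. split; [apply Rmin_glb_lt; lra|].
    unfold Rmin; destruct Rle_dec; lra. }
  assert (Hd1 : d <= s) by apply Rmin_l. assert (Hd2 : d <= 2 * PI - t) by apply Rmin_r.
  destruct (defect_0_tendsto d Hd) as [e [He Hb]].
  assert (Hlim : is_lim_seq (fun M => 2 * w + e M * (t - s)) (2 * w + 0 * (t - s))).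
  { apply is_lim_seq_plus'; [apply is_lim_seq_const|].
    apply is_lim_seq_scal_r with (lu := 0), He. }
  replace (2 * w + 0 * (t - s)) with (2 * w) in Hlim by ring.
  refine (is_lim_seq_le_loc (fun _ => _) _ (Rabs _) _ _ (is_lim_seq_const _) Hlim).
  exists N. intros M HM.
  assert (H1 := defect_1_tail N M t ltac:(lia) ltac:(lra)).
  assert (H2 := defect_1_tail N M s ltac:(lia) ltac:(lra)).
  assert (H3 : Rabs (defect 1 M t - defect 1 M s) <= e M * (t - s)).
  { apply mvt_abs_le with (defect 0 M); [lra | |].
    - intros x Hx. apply is_derive_defect. lra.
    - intros x Hx. apply Hb. lra. }
  fold w in H1, H2. apply Rabs_le_between in H1, H2, H3. apply Rabs_le. split; lra. }
assert (Hopen : forall t, 0 < t < 2 * PI -> Rabs (defect 1 N t) <= 2 * w).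
{ clear t. intros t Ht.
  rewrite <- (Rminus_0_r (defect 1 N t)).
  apply (filterlim_Rabs_le (at_right 0) (fun s => defect 1 N t - defect 1 N s)).
  - apply (filterlim_Rminus (at_right 0) (fun _ => defect 1 N t) (defect 1 N)); [apply filterlim_const | apply filterlim_defect].
  - apply filter_imp with (2 := at_right_between 0 t (proj1 Ht)).
    intros s Hs. apply Hst; lra. }
(* For fixed N the function [defect 1 N] is continuous at 2 PI, so the bound passes to that end from
   the left. *)
intros Ht. destruct (Rle_lt_or_eq_dec t (2 * PI) (proj2 Ht)) as [Hlt|Heq]; [apply Hopen; lra|].
apply (filterlim_Rabs_le (at_left t) (defect 1 N)).
- eapply filterlim_derive_at_left, is_derive_defect. lra.
- apply filter_imp with (2 := at_left_between 0 t (proj1 Ht)).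
  intros s Hs. apply Hopen. lra.
Qed.

Lemma defect_bound (j N : nat) (t : R) : (1 <= N)%nat -> 0 < t <= 2 * PI ->
  Rabs (defect (S j) N t) <= 2 * (2 + 2 * PI) * (2 * PI) ^ j * / INR N.
Proof.
intros HN. assert (HPI := PI_RGT_0).
assert (Hi : 0 < / INR N) by (apply Rinv_0_lt_compat, lt_0_INR; lia).
revert t. induction j as [|j IH]; intros t Ht.
- eapply Rle_trans; [apply defect_1_bound; assumption | simpl; right; ring].
- eapply Rle_trans; [apply defect_S_bound with (3 := Ht) (2 := IH)|].
  + assert (0 < (2 * PI) ^ j) by (apply pow_lt; lra).
    repeat apply Rmult_le_pos; lra.
  + simpl. right. ring.
Qed.

Lemma is_lim_seq_defect (j : nat) (t : R) : 0 < t <= 2 * PI ->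
  is_lim_seq (fun N => defect (S j) N t) 0.
Proof.
intros Ht. apply is_lim_seq_abs_0.
apply is_lim_seq_le_le_loc with (fun _ => 0)
  (fun N => 2 * (2 + 2 * PI) * (2 * PI) ^ j * / INR N).
- exists 1%nat. intros N HN. split; [apply Rabs_pos | apply defect_bound; assumption].
- apply is_lim_seq_const.
- set (a := 2 * (2 + 2 * PI) * (2 * PI) ^ j).
  replace (Finite 0) with (Finite (a * 0)) by (f_equal; ring).
  apply is_lim_seq_scal_l with (lu := 0).
  apply (is_lim_seq_inv _ p_infty); [apply is_lim_seq_INR | discriminate].
Qed.

(** * Even levels and passage to the limit *)

Lemma cos_sub_INR_PI (y : R) (m : nat) : cos (y - INR m * PI) = (-1) ^ m * cos y.
Proof.
induction m as [|m IH]; [simpl; rewrite Rmult_0_l, Rminus_0_r; ring|].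
replace (y - INR m * PI) with (y - INR (S m) * PI + PI) in IH by (rewrite S_INR; ring).
rewrite neg_cos in IH. rewrite <- tech_pow_Rmult. lra.
Qed.

Lemma cos_sub_even_quarter (y : R) (m : nat) :
  cos (y - INR (2 * m) * (PI / 2)) = (-1) ^ m * cos y.
Proof.
rewrite <- cos_sub_INR_PI, mult_INR. f_equal. simpl (INR 2). field.
Qed.

Lemma trig_sum_even (m N : nat) (t : R) :
  trig_sum (2 * m) N t =
  (-1) ^ m * psum (fun n => / INR (S n) ^ (2 * m + 1) * cos (INR (S n) * t)) N.
Proof.
rewrite <- psum_scal. apply psum_ext. intros n _.
rewrite cos_sub_even_quarter. replace (2 * m + 1)%nat with (S (2 * m)) by lia.
unfold Rdiv. ring.
Qed.

Lemma trig_sum_even_0 (m N : nat) :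
  trig_sum (2 * m) N 0 = (-1) ^ m * psum (fun n => / INR (S n) ^ (2 * m + 1)) N.
Proof.
rewrite trig_sum_even. f_equal. apply psum_ext. intros n _.
rewrite Rmult_0_r, cos_0. ring.
Qed.

(** At odd level the phase turns the cosines into sines, zero at 0. Hence the polynomial has only
    even powers of t, with zeta at odd arguments. *)
Lemma trig_sum_odd_0 (m N : nat) : trig_sum (2 * m + 1) N 0 = 0.
Proof.
unfold trig_sum. rewrite (psum_ext _ (fun _ => 0 * 0)); [rewrite psum_scal; ring|].
intros n _.
replace (INR (S n) * 0 - INR (2 * m + 1) * (PI / 2)) with (- (PI / 2) - INR (2 * m) * (PI / 2))
  by (rewrite (plus_INR (2 * m)); simpl (INR 1); ring).
rewrite cos_sub_even_quarter, cos_neg, cos_PI2. unfold Rdiv. ring.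
Qed.

Lemma taylor_part_even (r N : nat) (t : R) :
  taylor_part (2 * r) N t = psum (fun l =>
    (-1) ^ (r - l) * mono (2 * l) t * psum (fun n => / INR (S n) ^ (2 * r + 1 - 2 * l)) N) r.
Proof.
unfold taylor_part. rewrite psum_double. apply psum_ext. intros l Hl.
replace (2 * r - 2 * l)%nat with (2 * (r - l))%nat by lia.
replace (2 * r - (2 * l + 1))%nat with (2 * (r - l - 1) + 1)%nat by lia.
rewrite trig_sum_even_0, trig_sum_odd_0.
replace (2 * r + 1 - 2 * l)%nat with (2 * (r - l) + 1)%nat by lia. ring.
Qed.

Lemma is_lim_seq_taylor_part (r : nat) (t : R) :
  is_lim_seq (fun N => taylor_part (2 * r) N t) (psum (fun l =>
    (-1) ^ (r - l) * mono (2 * l) t * zeta (INR (2 * r + 1 - 2 * l))) r).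
Proof.
apply is_lim_seq_ext with (1 := fun N => eq_sym (taylor_part_even r N t)).
(* The upper bound becomes m while r stays fixed in the summand; m <= r keeps each exponent 2r + 1 -
   2l at least 3. *)
assert (H : forall m, (m <= r)%nat -> is_lim_seq (fun N => psum (fun l =>
    (-1) ^ (r - l) * mono (2 * l) t * psum (fun n => / INR (S n) ^ (2 * r + 1 - 2 * l)) N) m)
  (psum (fun l => (-1) ^ (r - l) * mono (2 * l) t * zeta (INR (2 * r + 1 - 2 * l))) m));
  [|apply H; lia].
induction m as [|m IH]; intros Hm; cbn [psum]; [apply is_lim_seq_const|].
apply is_lim_seq_plus'; [apply IH; lia|].
apply is_lim_seq_scal_l with (lu := zeta (INR (2 * r + 1 - 2 * m))), is_lim_seq_zeta. lia.
Qed.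

Lemma minus_one_pow_sub (r l : nat) : (l <= r)%nat -> (-1) ^ (r - l) = (-1) ^ r * (-1) ^ l.
Proof.
intros H. replace r with (r - l + l)%nat at 2 by lia.
rewrite pow_add, Rmult_assoc, <- Rpow_mult_distr.
replace (-1 * -1) with 1 by ring. rewrite pow1. ring.
Qed.

Lemma cosine_series_term_eq (c : R) (r : nat) (x : R) (n : nat) :
  cosine_series_term c r x (S n) = / INR (S n) ^ (2 * r + 1) * cos (INR (S n) * (PI * x / c)).
Proof.
unfold cosine_series_term, Rdiv. rewrite Rmult_1_l. do 2 f_equal. ring.
Qed.

Lemma ex_series_cosine (c : R) (r : nat) (x : R) : (1 <= r)%nat ->
  ex_series (fun n => cosine_series_term c r x (S n)).
Proof.
intros Hr. apply (ex_series_le (V := R_CompleteNormedModule)) with (fun n => / INR (S n) ^ (2 * r + 1)).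
- intros n. rewrite cosine_series_term_eq. unfold norm; simpl. unfold abs; simpl.
  assert (H : 0 < / INR (S n) ^ (2 * r + 1)) by apply Rinv_0_lt_compat, pow_lt, INR_S_pos.
  rewrite Rabs_mult, Rabs_pos_eq by (left; exact H).
  rewrite <- (Rmult_1_r (/ _)) at 2.
  apply Rmult_le_compat_l; [left; exact H | apply Rabs_le, COS_bound].
- apply ex_series_inv_pow. lia.
Qed.

(** The PI^(2k+2) in the power of PI x/c cancels that of (2 PI)^(2k+2), and the 2 of [zeta_coef]
    leaves 2^(2k+1). *)
Lemma zeta_series_term_eq (c : R) (r : nat) (x : R) (k : nat) : 0 < c ->
  (PI * x / c) ^ (2 * r) * zeta_series_term c r x (S k) =
  zeta_coef k * mono (2 * r + (2 * k + 2)) (PI * x / c).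
Proof.
intros Hc. unfold zeta_series_term, zeta_coef, mono.
replace (2 * S k)%nat with (2 * k + 2)%nat by lia.
replace (2 * k + 2 - 1)%nat with (2 * k + 1)%nat by lia.
rewrite (pow_add (PI * x / c) (2 * r)).
replace ((PI * x / c) ^ (2 * k + 2)) with (PI ^ (2 * k + 2) * (x / c) ^ (2 * k + 2))
  by (rewrite <- Rpow_mult_distr; f_equal; field; lra).
rewrite Rpow_mult_distr.
replace (2 ^ (2 * k + 2)) with (2 * 2 ^ (2 * k + 1))
  by (replace (2 * k + 2)%nat with (S (2 * k + 1)) by lia; reflexivity).
assert (HPI := PI_RGT_0). field.
repeat split; first [lra | apply INR_fact_neq_0 | apply pow_nonzero; lra].
Qed.

Theorem theorem16 (c : R) (hc : 0 < c) (r : nat) (hr : (1 <= r)%nat)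
    (x : R) (hx0 : 0 <= x) (hx : x <= 2 * c) :
  ex_series (fun n : nat => cosine_series_term c r x (S n)) /\
  ex_series (fun k : nat => zeta_series_term c r x (S k)) /\
  Series (fun n : nat => cosine_series_term c r x (S n)) =
    sum_n_m (fun k : nat =>
      (-1) ^ k * (1 / INR (fact (2 * k))) * (PI * x / c) ^ (2 * k)
        * zeta (INR (2 * r + 1 - 2 * k))) 0 (r - 1)
    + (-1) ^ r * (1 / INR (fact (2 * r))) * (PI * x / c) ^ (2 * r)
        * (harmonic (2 * r) - ln (PI * x / c))
    + (-1) ^ r * (PI * x / c) ^ (2 * r)
        * Series (fun k : nat => zeta_series_term c r x (S k)).
Proof.
assert (HPI := PI_RGT_0).
assert (Hcos := ex_series_cosine c r x hr).
split; [exact Hcos|].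
fold (sum_n (fun k : nat =>
      (-1) ^ k * (1 / INR (fact (2 * k))) * (PI * x / c) ^ (2 * k)
        * zeta (INR (2 * r + 1 - 2 * k))) (r - 1)).
rewrite <- psum_sum_n. replace (S (r - 1)) with r by lia.
destruct (Rle_lt_or_eq_dec 0 x hx0) as [Hx|<-].
- set (t := PI * x / c).
  assert (Ht : 0 < t <= 2 * PI).
  { unfold t. split; [apply Rdiv_lt_0_compat; nra | apply Rle_div_l; nra]. }
  assert (Htr : 0 < t ^ (2 * r)) by (apply pow_lt; lra).
  set (C := Series (fun n => cosine_series_term c r x (S n))).
  set (P := psum (fun l => (-1) ^ (r - l) * mono (2 * l) t * zeta (INR (2 * r + 1 - 2 * l))) r).
  set (L := (-1) ^ r * C - P - log_part (2 * r) t).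
  assert (HT : is_lim_seq (fun N => trig_sum (2 * r) N t) ((-1) ^ r * C)).
  { apply is_lim_seq_ext with (1 := fun N => eq_sym (trig_sum_even r N t)).
    apply is_lim_seq_scal_l with (lu := C), is_lim_seq_psum.
    apply is_series_ext with (1 := cosine_series_term_eq c r x).
    apply Series_correct, Hcos. }
  assert (HD : is_lim_seq (fun N => defect (2 * r) N t) 0).
  { replace (2 * r)%nat with (S (2 * r - 1)) by lia. apply is_lim_seq_defect, Ht. }
  (* Convergence of the zeta series needs no estimate of its own: its partial sums are a combination
     of sequences with known limits. *)
  assert (HZ : is_lim_seq (fun N => zeta_sum (2 * r) N t) L).
  { apply is_lim_seq_ext with (fun N =>
      trig_sum (2 * r) N t - taylor_part (2 * r) N t - log_part (2 * r) t - defect (2 * r) N t).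
    { intros N. unfold defect. ring. }
    replace (Finite L) with (Finite ((-1) ^ r * C - P - log_part (2 * r) t - 0))
      by (unfold L; f_equal; ring).
    repeat apply is_lim_seq_minus';
      [exact HT | apply is_lim_seq_taylor_part | apply is_lim_seq_const | exact HD]. }
  assert (Hser : is_series (fun k => zeta_series_term c r x (S k)) (/ t ^ (2 * r) * L)).
  { assert (E : forall k, / t ^ (2 * r) * (zeta_coef k * mono (2 * r + (2 * k + 2)) t)
      = zeta_series_term c r x (S k)).
    { intros k. unfold t at 2. rewrite <- zeta_series_term_eq by exact hc. fold t. field. lra. }
    apply is_series_ext with (1 := E).
    apply (is_series_scal (V := R_NormedModule)), is_lim_seq_psum, HZ. }
  split; [exists (/ t ^ (2 * r) * L); exact Hser|].
  rewrite (is_series_unique _ _ Hser).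
  assert (Hsq : (-1) ^ r * (-1) ^ r = 1)
    by (rewrite <- Rpow_mult_distr; replace (-1 * -1) with 1 by ring; apply pow1).
  assert (Hinv : forall y, (-1) ^ r * ((-1) ^ r * y) = y)
    by (intros y; rewrite <- Rmult_assoc, Hsq; ring).
  assert (HP : psum (fun k => (-1) ^ k * (1 / INR (fact (2 * k))) * t ^ (2 * k)
      * zeta (INR (2 * r + 1 - 2 * k))) r = (-1) ^ r * P).
  { unfold P. rewrite <- psum_scal. apply psum_ext. intros l Hl.
    rewrite minus_one_pow_sub by lia. unfold mono, Rdiv.
    rewrite !(Rmult_assoc ((-1) ^ r)), Hinv. ring. }
  rewrite HP.
  replace ((-1) ^ r * t ^ (2 * r) * (/ t ^ (2 * r) * L)) with ((-1) ^ r * L) by (field; lra).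
  unfold L, log_part, mono, Rdiv.
  rewrite <- (Hinv C) at 1. ring.
(* At x = 0 division by t^(2r) is impossible. As r >= 1, the power 0^(2r) removes the logarithmic
   term whatever the value of [ln 0], in accordance with the limit 0; only the term k = 0 survives,
   and both sides are zeta(2r+1). *)
- assert (Ht : PI * 0 / c = 0) by (field; lra). rewrite Ht.
  assert (Hz : forall k, zeta_series_term c r 0 (S k) = 0).
  { intros k. unfold zeta_series_term. replace (0 / c) with 0 by (field; lra).
    rewrite pow_ne_zero by lia. ring. }
  split.
  + exists 0. apply is_lim_seq_psum.
    apply is_lim_seq_ext with (fun _ => 0); [|apply is_lim_seq_const].
    induction n as [|n IH]; cbn [psum]; [reflexivity | rewrite <- IH, Hz; ring].
  + rewrite (pow_ne_zero (2 * r)) by lia.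
    destruct r as [|r]; [lia|]. rewrite psum_Sl.
    rewrite (psum_ext _ (fun _ => 0 * 0)).
    2: { intros k _. rewrite (pow_ne_zero (2 * S k)) by lia. ring. }
    rewrite psum_scal. rewrite zeta_INR, Nat.mul_0_r, Nat.sub_0_r.
    rewrite (Series_ext _ (fun n => / INR (S n) ^ (2 * S r + 1))).
    * simpl. field. apply (INR_fact_neq_0 (2 * S r)).
    * intros n. rewrite cosine_series_term_eq, Ht, Rmult_0_r, cos_0. ring.
Qed.
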